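(* Let $G=(V,E)$ be a directed graph with source $s$, sink $t$, unit capacities $u\equiv 1$, and let $k$ be a nonnegative integer. Then every maximum $s$-$t$-flow $x$ (i.e., an $s$-$t$-flow maximizing $\sum_{P\in\mathcal{P}}x(P)$) is a maximum robust flow, i.e., it maximizes $\operatorname{val_r}$ over all $s$-$t$-flows.
   Context: Let $\mathcal{P}$ be the set of $s$-$t$-paths in $G$ and $\mathcal{S}=\{S\subseteq E : |S|=k\}$. An $s$-$t$-flow is a vector $x\in\mathbb{R}_+^{\mathcal{P}}$ with $\sum_{P: e\in P} x(P)\le u(e)$ for all $e\in E$. Its robust flow value is $\operatorname{val_r}(x)=\sum_{P\in\mathcal{P}}x(P)-\max_{S\in\mathcal{S}}\sum_{P\in\mathcal{P}: P\cap S\neq\emptyset}x(P)$. *)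

(* Defs.v *)
From HB Require Import structures.
From mathcomp Require Import all_boot all_order all_algebra.

Set Implicit Arguments.
Unset Strict Implicit.
Unset Printing Implicit Defensive.

Import Order.TTheory GRing.Theory Num.Theory.

Local Open Scope ring_scope.

(* Parallel arcs and loops are allowed; a simple digraph is the special case
   where e |-> (src e, tgt e) is injective. *)
Record digraph := Digraph {
  vertex : finType;
  edge : finType;
  src : edge -> vertex;
  tgt : edge -> vertex }.

Section Paths.
Variables (G : digraph) (s t : vertex G).

Fixpoint walk (a : vertex G) (p : seq (edge G)) (b : vertex G) : bool :=
  if p is e :: p' then (src e == a) && walk (tgt e) p' b else a == b.

(* s :: map tgt p is the sequence of vertices visited by a walk p from s. *)
Definition is_stpath (p : seq (edge G)) : bool :=
  walk s p t && uniq (s :: map (@tgt G) p).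

(* The length bound only serves to make this a finite type: by
   size_is_stpath it excludes no path. *)
Definition stpath := {p : #|edge G|.-bseq (edge G) | is_stpath p}.

HB.instance Definition _ := Finite.on stpath.

Lemma size_is_stpath (p : seq (edge G)) :
  is_stpath p -> (size p <= #|edge G|)%N.
Proof.
case/andP=> _ /= /andP[_ /map_uniq Up].
by rewrite -(card_uniqP Up) max_card.
Qed.

Definition edges (P : stpath) : {set edge G} := [set e in val (val P)].

End Paths.

Section Flows.
Variables (R : realFieldType) (G : digraph) (s t : vertex G).
Implicit Types (u : edge G -> R) (x : {ffun stpath s t -> R}).

Definition is_flow u x : Prop :=
  (forall P, 0 <= x P) /\
  (forall e : edge G, \sum_(P : stpath s t | e \in edges P) x P <= u e).

Definition flow_val x : R := \sum_(P : stpath s t) x P.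

(* For a flow every loss below is nonnegative, so the base point 0 does not
   affect the maximum when k <= #|edge G|.  When k > #|edge G| there is no S
   with #|S| = k, and the maximum is 0 by convention. *)
Definition val_r (k : nat) x : R :=
  flow_val x -
  \big[Num.max/0]_(S : {set edge G} | #|S| == k)
     \sum_(P : stpath s t | edges P :&: S != set0) x P.

Definition is_max_flow u x : Prop :=
  is_flow u x /\ (forall y, is_flow u y -> flow_val y <= flow_val x).

Definition is_max_robust_flow u (k : nat) x : Prop :=
  is_flow u x /\ (forall y, is_flow u y -> val_r k y <= val_r k x).

End Flows.

(* Main.v *)
(* With unit capacities, deleting k edges costs a flow at most k, so a maximum
   flow x has robust value at least max(0, val x - k).  By max-flow min-cut there
   is a cut C with #|C| <= val x; deleting k edges of C (or a superset of C of
   size k) leaves any flow y with value at most max(0, #|C| - k).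

   For max-flow min-cut, suppose t is reachable from s in the residual graph of
   x.  Pushing a small amount along a residual walk yields an edge flow whose net
   flow through every s-t-cut exceeds val x, and such an edge flow dominates a
   path flow of the same value: subtract s-t-paths in its support one by one. *)
Require Import Defs.
From HB Require Import structures.
From mathcomp Require Import all_boot all_order all_algebra.
From mathcomp Require Import lra.

Set Implicit Arguments.
Unset Strict Implicit.
Unset Printing Implicit Defensive.

Import Order.TTheory GRing.Theory Num.Theory.

Local Open Scope ring_scope.

(** List [C] first and its complement after it, and take the first [k] elements; truncated
    subtraction covers the case [#|C| <= k]. *)
Lemma exists_card_set_cover (T : finType) (C : {set T}) (k : nat) :
  (k <= #|T|)%N ->
  exists2 S : {set T}, #|S| = k & (#|C :\: S| <= #|C| - k)%N.
Proof.
move=> lekT; pose r := enum C ++ enum (~: C).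
have Ur : uniq r.
  rewrite cat_uniq !enum_uniq andbT /=; apply/hasPn => e.
  by rewrite !mem_enum inE.
have szr : size r = #|T| by rewrite size_cat -!cardE cardsC.
exists [set e in take k r].
  by rewrite cardsE (card_uniqP (take_uniq _ Ur)) size_takel // szr.
rewrite [X in (_ <= X - _)%N]cardE -size_drop.
apply: leq_trans (card_size _); apply: subset_leq_card; apply/subsetP => e.
rewrite !inE => /andP[eS eC].
have := eC; rewrite -mem_enum -{1}(cat_take_drop k (enum C)) mem_cat.
case/orP => // etk; case/negP: eS; rewrite /r take_cat.
by case: ltnP => // lek; rewrite mem_cat; apply/orP; left; apply: mem_take etk.
Qed.

Lemma sum_delta (R : pzSemiRingType) (T : finType) (A : pred T) (a : T) :
  \sum_(b | A b) (b == a)%:R = (A a)%:R :> R.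
Proof.
rewrite big_mkcond (bigD1 a) //= eqxx big1 ?addr0 => [|b /negPf->].
  by case: (A a).
by case: (A b).
Qed.

(** * Net flow through vertex sets *)

Section Netflow.
Variables (R : realFieldType) (G : digraph).
Implicit Types (f g : edge G -> R) (A : {set vertex G}).

(** Signed flow out of [A], linear in [f]. Bounding it on all s-t-cuts stands in for flow
    conservation below. *)
Definition netflow f A : R :=
  \sum_e f e * ((src e \in A)%:R - (tgt e \in A)%:R).

Lemma netflowDZ f g (c : R) A :
  netflow (fun e => f e + c * g e) A = netflow f A + c * netflow g A.
Proof.
rewrite /netflow mulr_sumr -big_split; apply: eq_bigr => e _ /=.
by rewrite mulrDl mulrA.
Qed.

Lemma netflow_edge e0 A :
  netflow (fun e => (e == e0)%:R) A = (src e0 \in A)%:R - (tgt e0 \in A)%:R.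
Proof.
rewrite /netflow (bigD1 e0) //= eqxx mul1r big1 ?addr0 // => e /negPf->.
by rewrite mul0r.
Qed.

(** The contributions telescope along the walk; [uniq p] makes the indicator count each
    traversal. *)
Lemma netflow_walk (p : seq (edge G)) a b A :
  uniq p -> walk a p b ->
  netflow (fun e => (e \in p)%:R) A = (a \in A)%:R - (b \in A)%:R.
Proof.
move=> Up Wp.
transitivity (\sum_(e <- p) ((src e \in A)%:R - (tgt e \in A)%:R : R)).
  rewrite big_uniq //= /netflow [RHS]big_mkcond; apply: eq_bigr => e _.
  by case: (e \in p); rewrite ?mul1r ?mul0r.
elim: p a Wp {Up} => [|e p IH] a /=; first by move/eqP->; rewrite big_nil subrr.
by case/andP=> /eqP<- /IH; rewrite big_cons => ->; rewrite addrA subrK.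
Qed.

Lemma walk_crosses (p : seq (edge G)) a b A :
  walk a p b -> a \in A -> b \notin A ->
  exists2 e, e \in p & (src e \in A) && (tgt e \notin A).
Proof.
elim: p a => [|e p IH] a /=; first by move/eqP-> => ->.
case/andP=> /eqP sa We aA bA; case: (boolP (tgt e \in A)) => [tA|tA].
  by have [e' e'p Ce'] := IH _ We tA bA; exists e'; rewrite ?inE ?e'p ?orbT.
by exists e; rewrite ?mem_head // sa aA.
Qed.

Lemma walk_of_path (r : pred (edge G)) a (p : seq (vertex G)) :
  path (fun v w => [exists e, [&& r e, src e == v & tgt e == w]]) a p ->
  exists q, [/\ walk a q (last a p), map (@tgt G) q = p & all r q].
Proof.
elim: p a => [|b p IH] a /=; first by exists [::]; rewrite /= eqxx.
case/andP=> /existsP[e /and3P[re /eqP sa /eqP tb]] /IH[q [Wq tq rq]].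
by exists (e :: q); rewrite /= sa tb eqxx tq re rq.
Qed.

End Netflow.

(** * Path flows and the edge flows they induce *)

Section PathFlows.
Variables (R : realFieldType) (G : digraph) (s t : vertex G).
Implicit Types (f g : edge G -> R) (x y : {ffun stpath s t -> R}).
Implicit Types (A : {set vertex G}).

Definition edge_flow x (e : edge G) : R :=
  \sum_(P : stpath s t | e \in edges P) x P.

Lemma netflow_stpath (P : stpath s t) A :
  s \in A -> t \notin A -> netflow (fun e => (e \in edges P)%:R : R) A = 1.
Proof.
move=> sA /negPf tA; case/andP: (valP P) => Wp /= /andP[_ /map_uniq Up].
have := netflow_walk R A Up Wp; rewrite sA tA subr0 mulr1n; apply: etrans.
by apply: eq_bigr => e _; rewrite inE.
Qed.

Lemma edge_flow_netflow x A :
  s \in A -> t \notin A -> netflow (edge_flow x) A = flow_val x.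
Proof.
move=> sA tA; rewrite /netflow /edge_flow.
under eq_bigr => e _ do rewrite big_mkcond mulr_suml.
rewrite exchange_big; apply: eq_bigr => P _ /=.
transitivity (x P * netflow (fun e => (e \in edges P)%:R) A); last first.
  by rewrite netflow_stpath // mulr1.
rewrite mulr_sumr; apply: eq_bigr => e _.
by case: (e \in _); rewrite ?mul1r ?mul0r ?mulr0.
Qed.

Lemma sum_edge_flow x (D : {set edge G}) :
  \sum_(e in D) edge_flow x e = \sum_P x P * #|edges P :&: D|%:R.
Proof.
rewrite /edge_flow; under eq_bigr => e _ do rewrite big_mkcond.
rewrite exchange_big; apply: eq_bigr => P _ /=.
rewrite -big_mkcondr mulr_natr -sumr_const; apply: eq_bigl => e.
by rewrite in_setI andbC.
Qed.

(** A path meeting [D] counts once on the left and once per common edge on the right. *)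
Lemma hitting_le_edge_flow x (D : {set edge G}) :
  (forall P, 0 <= x P) ->
  \sum_(P | edges P :&: D != set0) x P <= \sum_(e in D) edge_flow x e.
Proof.
move=> x0; rewrite sum_edge_flow big_mkcond; apply: ler_sum => P _.
case: ifP => [|_]; last by rewrite mulr_ge0.
rewrite -card_gt0 => D0; rewrite -[leLHS]mulr1; apply: ler_wpM2l => //.
by rewrite ler1n.
Qed.

Lemma hitting_le_card x (D : {set edge G}) :
  is_flow (fun=> 1) x ->
  \sum_(P | edges P :&: D != set0) x P <= #|D|%:R.
Proof.
case=> x0 x1; apply: le_trans (hitting_le_edge_flow D x0) _.
by rewrite -sumr_const; apply: ler_sum => e _; apply: x1.
Qed.

(** * Decomposing edge flows into paths *)

Lemma support_stpath f (V : R) :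
  (forall e, 0 <= f e) -> 0 < V ->
  (forall A, s \in A -> t \notin A -> V <= netflow f A) ->
  exists P : stpath s t, forall e, e \in edges P -> 0 < f e.
Proof.
move=> f0 V0 fV.
pose r (v w : vertex G) :=
  [exists e, [&& 0 < f e, src e == v & tgt e == w]].
case: (boolP (connect r s t)) => [/connectP[p0 rp0 et]|Nst].
  rewrite {}et in fV *; case/shortenP: rp0 => p rp Up _.
  have [q [Wq tq rq]] := walk_of_path rp.
  have Pq : is_stpath s (last s p) q by rewrite /is_stpath Wq tq.
  exists (Sub (Bseq (size_is_stpath Pq)) Pq) => e.
  by rewrite inE /= => /(allP rq).
(* No edge with [0 < f e] leaves [A], so [netflow f A <= 0], contradicting [0 < V]. *)
pose A := [set v | connect r s v].
have: V <= netflow f A by apply: fV; rewrite inE ?connect0.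
rewrite leNgt (le_lt_trans _ V0) // -oppr_ge0 -sumrN sumr_ge0 // => e _.
rewrite -mulrN opprB !inE; case: (boolP (connect r s (src e))) => [se|_].
  case: (boolP (connect r s (tgt e))) => [_|te]; first by rewrite subrr mulr0.
  have [fe|fe] := ltP 0 (f e); last first.
    by rewrite (@le_anti _ _ (f e) 0) ?mul0r // fe f0.
  case/negP: te; apply: connect_trans se (connect1 _).
  by apply/existsP; exists e; rewrite fe !eqxx.
by rewrite subr0 mulr_ge0.
Qed.

(** Induction on the size of the support: subtracting a path at its bottleneck value [d] removes an
    edge from the support and lowers every s-t-cut by exactly [d]. Only domination by [f] is
    claimed, so cycles and surplus may remain. *)
Lemma flow_decomposition f (V : R) : s != t ->
  (forall e, 0 <= f e) ->
  (forall A, s \in A -> t \notin A -> V <= netflow f A) ->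
  exists y, [/\ forall P, 0 <= y P, forall e, edge_flow y e <= f e
    & V <= flow_val y].
Proof.
move=> st; have [n] := ubnP #|[set e | 0 < f e]|.
elim: n f V => // n IH f V fn f0 fV.
have [V0|V0] := leP V 0.
  exists [ffun=> 0]; split=> [P|e|]; first by rewrite ffunE.
    by rewrite /edge_flow big1 // => P _; rewrite ffunE.
  by rewrite /flow_val big1 // => P _; rewrite ffunE.
have [P fP] := support_stpath f0 V0 fV.
(* Since [s != t], the path has an edge, so a bottleneck edge [e1] exists. *)
have [e0 e0P] : exists e, e \in edges P.
  case/andP: (valP P) => Wp _.
  have [||e ep _] := walk_crosses (A := [set s]) Wp; rewrite ?inE // 1?eq_sym //.
  by exists e; rewrite inE.
case: (@arg_minP _ _ _ e0 [in edges P] f e0P) => e1 /= e1P fmin.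
pose d := f e1; have d0 : 0 < d by apply: fP.
pose f' e := f e + - d * (e \in edges P)%:R.
have f'0 e : 0 <= f' e.
  rewrite /f'; case: (boolP (e \in edges P)) => [/fmin|_].
    by rewrite mulr1 subr_ge0.
  by rewrite mulr0 addr0.
have f'f e : f' e <= f e by rewrite gerDl mulNr oppr_le0 mulr_ge0 // ltW.
have [|||y [y0 yf yV]] := IH f' (V - d) => //.
- rewrite ltnS in fn; apply: leq_trans fn; apply: proper_card; apply/properP; split.
    by apply/subsetP => e; rewrite !inE => /lt_le_trans; apply; apply: f'f.
  by exists e1; rewrite inE ?fP // /f' e1P mulr1 subrr ltxx.
- move=> A sA tA; rewrite /f' netflowDZ netflow_stpath // mulr1 lerD2r.
  exact: fV.
exists [ffun Q => y Q + d * (Q == P)%:R]; split=> [Q|e|].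
- by rewrite ffunE addr_ge0 // mulr_ge0 // ltW.
- have -> : edge_flow [ffun Q => y Q + d * (Q == P)%:R] e =
      edge_flow y e + d * (e \in edges P)%:R.
    rewrite /edge_flow; under eq_bigr => Q _ do rewrite ffunE.
    by rewrite big_split -mulr_sumr /= sum_delta.
  by have := yf e; rewrite /f'; lra.
rewrite /flow_val; under eq_bigr => Q _ do rewrite ffunE.
by rewrite big_split -mulr_sumr /= sum_delta mulr1 -lerBlDr.
Qed.

(** * Residual reachability and max-flow min-cut *)

Definition residual f (v w : vertex G) : bool :=
  [exists e, [&& f e < 1, src e == v & tgt e == w]
          || [&& 0 < f e, tgt e == v & src e == w]].

(** [g] counts forward minus backward traversals along a residual walk. A nonzero sign of [g e]
    forces a traversal in that direction, so the walk may repeat edges. *)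
Lemma residual_unit_flow f v : connect (residual f) s v ->
  exists g, [/\ forall A, netflow g A = (s \in A)%:R - (v \in A)%:R,
    forall e, 0 < g e -> f e < 1 & forall e, g e < 0 -> 0 < f e].
Proof.
case/connectP=> p; elim/last_ind: p v => [|p w IH] v.
  move=> _ ->; exists (fun=> 0); split=> [A|e|e]; rewrite ?ltxx //= subrr.
  by rewrite /netflow big1 // => e _; rewrite mul0r.
rewrite rcons_path last_rcons => /andP[rp rw] ->{v}.
have [g [gA g1 g0]] := IH _ rp erefl.
case/existsP: rw => e /orP[] /and3P[fe /eqP <- /eqP <-] in gA *.
  exists (fun e' => g e' + 1 * (e' == e)%:R); split=> [A|e'|e'].
  - by rewrite netflowDZ gA netflow_edge; lra.
  - by have [->//|_] := eqVneq e' e; rewrite mulr0 addr0; apply: g1.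
  - by move=> ge'; apply: g0; have := ler0n R (e' == e); lra.
exists (fun e' => g e' + -1 * (e' == e)%:R); split=> [A|e'|e'].
- by rewrite netflowDZ gA netflow_edge; lra.
- by move=> ge'; apply: g1; have := ler0n R (e' == e); lra.
- by have [->//|_] := eqVneq e' e; rewrite mulr0 addr0; apply: g0.
Qed.

Lemma small_step f g :
  (forall e, 0 <= f e <= 1) ->
  (forall e, 0 < g e -> f e < 1) -> (forall e, g e < 0 -> 0 < f e) ->
  exists2 c, 0 < c & forall e, 0 <= f e + c * g e <= 1.
Proof.
move=> f01 g1 g0.
(* Allowing every [d] up to [c] lets the bounds for single edges be combined by a minimum. *)
have step e : exists2 c, 0 < c & forall d, 0 <= d <= c -> 0 <= f e + d * g e <= 1.
  have /andP[fe0 fe1] := f01 e; case: (ltrgt0P (g e)) => [ge|ge|->].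
  - exists ((1 - f e) / g e); first by rewrite divr_gt0 // subr_gt0 g1.
    move=> d /andP[d0]; rewrite ler_pdivlMr // => dle.
    by have := mulr_ge0 d0 (ltW ge); lra.
  - exists (f e / - g e); first by rewrite divr_gt0 ?oppr_gt0 // g0.
    move=> d /andP[d0]; rewrite ler_pdivlMr ?oppr_gt0 // mulrN => dle.
    by have := mulr_ge0_le0 d0 (ltW ge); lra.
  - by exists 1 => // d _; rewrite mulr0 addr0 fe0.
suff [c c0 cP] : exists2 c, 0 < c &
    forall e, e \in enum (edge G) -> forall d, 0 <= d <= c -> 0 <= f e + d * g e <= 1.
  by exists c => // e; apply: (cP e); rewrite ?mem_enum // lexx ltW.
elim: (enum _) => [|e r [c c0 cP]]; first by exists 1.
have [b b0 bP] := step e; exists (Num.min b c); first by rewrite lt_min b0.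
move=> e'; rewrite inE => /orP[/eqP->|e'r] d; rewrite le_min => /and3P[d0 db dc].
  by apply: bP; rewrite d0.
by apply: cP => //; rewrite d0.
Qed.

Lemma max_flow_cut x : s != t -> is_max_flow (fun=> 1) x ->
  exists2 C : {set edge G}, (forall P : stpath s t, edges P :&: C != set0)
    & #|C|%:R <= flow_val x.
Proof.
move=> st [[x0 x1] xmax]; set f := edge_flow x.
have f0 e : 0 <= f e by apply: sumr_ge0.
have Nst : ~~ connect (residual f) s t.
  (* Augmenting by [c * g] raises the net flow through every s-t-cut to [flow_val x + c]; its
     decomposition would beat [x]. *)
  apply/negP => /residual_unit_flow[g [gA g1 g0]].
  have f01 e : 0 <= f e <= 1 by rewrite f0 x1.
  have [c c0 cP] := small_step f01 g1 g0.
  have [|A sA tA|y [y0 yf yV]] := @flow_decomposition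
    (fun e => f e + c * g e) (flow_val x + c) st.
  - by move=> e; case/andP: (cP e).
  - by rewrite netflowDZ edge_flow_netflow // gA sA (negPf tA) subr0 mulr1.
  have /xmax : is_flow (fun=> 1) y.
    by split=> // e; apply: le_trans (yf e) _; case/andP: (cP e).
  by rewrite leNgt (lt_le_trans _ yV) // ltrDl.
pose A := [set v | connect (residual f) s v].
have sA : s \in A by rewrite inE connect0.
have tA : t \notin A by rewrite inE.
exists [set e | (src e \in A) && (tgt e \notin A)] => [P|].
  case/andP: (valP P) => Wp _; have [e ep Ce] := walk_crosses Wp sA tA.
  have eP : e \in edges P by rewrite inE.
  by apply/set0Pn; exists e; rewrite in_setI eP inE.
(* Compare edge by edge: edges leaving [A] are saturated and edges entering it carry no flow, as
   otherwise [A] would grow. *)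
rewrite -(edge_flow_netflow x sA tA) -sumr_const /netflow big_mkcond.
apply: ler_sum => e _ /=; rewrite inE -/f.
case: (boolP (src e \in A)) => se; case: (boolP (tgt e \in A)) => te /=.
- by rewrite subrr mulr0.
- rewrite subr0 mulr1 leNgt; apply/negP => fe; case/negP: te.
  move: se; rewrite !inE => se; apply: connect_trans se (connect1 _).
  by apply/existsP; exists e; rewrite fe !eqxx.
- have [fe|fe] := ltP 0 (f e); last first.
    by rewrite (@le_anti _ _ (f e) 0) ?mul0r // fe f0.
  case/negP: se; move: te; rewrite !inE => te; apply: connect_trans te (connect1 _).
  by apply/existsP; exists e; rewrite fe !eqxx orbT.
- by rewrite subrr mulr0.
Qed.

(** * Bounds on the robust value *)

Lemma val_r_ge k x : is_flow (fun=> 1) x -> Num.max 0 (flow_val x - k%:R) <= val_r k x.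
Proof.
move=> xflow; have x0 := xflow.1; rewrite /val_r ge_max subr_ge0 lerD2l lerN2.
apply/andP; split; apply: bigmax_le => //; rewrite ?sumr_ge0 // => S /eqP Sk.
  by rewrite /flow_val [leRHS](bigID (fun P => edges P :&: S != set0)) lerDl sumr_ge0.
by rewrite -Sk; apply: hitting_le_card.
Qed.

(** Delete a set [S] of size [k] covering as much of [C] as possible; each surviving path uses an
    edge of [C :\: S], and these have unit capacity. The bound on [k] ensures that such an [S]
    exists. *)
Lemma val_r_le_cut k x (C : {set edge G}) : is_flow (fun=> 1) x ->
  (forall P : stpath s t, edges P :&: C != set0) -> (k <= #|edge G|)%N ->
  val_r k x <= (#|C| - k)%:R.
Proof.
move=> xflow hitC lek; have [S Sk CS] := exists_card_set_cover C lek.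
apply: le_trans (_ : #|C :\: S|%:R <= _); last by rewrite ler_nat.
apply: le_trans (hitting_le_card (C :\: S) xflow); rewrite /val_r lerBlDl.
rewrite /flow_val (bigID (fun P => edges P :&: S != set0)) /=; apply: lerD.
  by apply: (le_bigmax_cond _ (fun S => \sum_(P | edges P :&: S != set0) x P)); apply/eqP.
rewrite [leLHS]big_mkcond [leRHS]big_mkcond; apply: ler_sum => P _.
case: ifP => [/negPn/eqP PS|_]; last by case: ifP => // _; apply: xflow.1.
suff -> : edges P :&: (C :\: S) = edges P :&: C by rewrite hitC.
by rewrite setIDA; apply/setDidPl; rewrite -setI_eq0 setIAC PS set0I.
Qed.

(* The empty path then carries unbounded flow. *)
Lemma max_flow_source_neq_sink u x : is_max_flow u x -> s != t.
Proof.
case=> [[x0 x1] xmax]; apply/negP => /eqP st.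
have P0 : is_stpath s t [::] by rewrite /is_stpath /= st eqxx.
pose P : stpath s t := Sub (Bseq (size_is_stpath P0)) P0.
pose y := [ffun Q => x Q + (Q == P)%:R].
have /xmax : is_flow u y.
  split=> [Q|e]; first by rewrite ffunE addr_ge0.
  apply: le_trans (x1 e); apply: ler_sum => Q eQ; rewrite ffunE.
  by have [QP|_] := eqVneq Q P; [rewrite QP inE in eQ | rewrite addr0].
rewrite /flow_val; under eq_bigr => Q _ do rewrite ffunE.
by rewrite big_split /= sum_delta gerDl ler10.
Qed.

End PathFlows.

Theorem theorem7 (R : realFieldType) (G : digraph) (s t : vertex G) (k : nat)
    (x : {ffun stpath s t -> R}) :
  is_max_flow (fun _ : edge G => 1) x ->
  is_max_robust_flow (fun _ : edge G => 1) k x.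
Proof.
move=> xmax; have [xflow xval] := xmax; split=> // y yflow.
(* For [k > #|edge G|] the maximum is over no sets and defaults to 0, so [val_r] is [flow_val]. *)
have [lek|ltk] := leqP k #|edge G|; last first.
  have noS (S : {set edge G}) : (#|S| == k) = false.
    by apply/negbTE; rewrite neq_ltn (leq_ltn_trans (max_card _) ltk).
  by rewrite /val_r !(big_pred0 _ _ _ _ noS) !subr0; apply: xval.
have [C hitC Cx] := max_flow_cut (max_flow_source_neq_sink xmax) xmax.
apply: le_trans (val_r_le_cut yflow hitC lek) _.
apply: le_trans (val_r_ge k xflow); rewrite le_max.
(* The truncated [#|C| - k] is 0 in the first case, matching the 0 in the maximum; otherwise it is
   at most [flow_val x - k%:R]. *)
have [Ck|kC] := leqP #|C| k; first by rewrite (eqP Ck) lexx.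
by rewrite natrB 1?ltnW // lerD2r Cx orbT.
Qed.
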